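(* Let $\kappa$ be an infinite cardinal and let $(X_\alpha)_{\alpha\in A}$ be a family of ${\uparrow}\kappa$-complete topologized posets. Then the Tychonoff product $X:=\prod_{\alpha\in A}X_\alpha$ is an ${\uparrow}\kappa$-complete topologized poset.
   Context: A topologized poset is a partially ordered set $(X,\le)$ endowed with a topology (no compatibility between order and topology is assumed). $\overline{D}$ denotes the closure of $D$. A subset $D\subseteq X$ is up-directed if for any $x,y\in D$ there is $z\in D$ with $x\le z$ and $y\le z$. For a cardinal $\kappa$, a topologized poset $X$ is ${\uparrow}\kappa$-complete if each nonempty up-directed set $D\subseteq X$ of cardinality $|D|\le\kappa$ has a least upper bound $\sup D$ in $X$ and $\sup D\in\overline{D}$. The Tychonoff product $\prod_{\alpha\in A}X_\alpha$ of topologized posets $(X_\alpha,\le_\alpha)$ carries the product topology and the pointwise partial order: $(x_\alpha)_{\alpha\in A}\le(y_\alpha)_{\alpha\in A}$ iff $x_\alpha\le_\alpha y_\alpha$ for each $\alpha\in A$. *)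

(* Defs.v *)
From HB Require Import structures.
From mathcomp Require Import all_boot all_order all_classical topology.

Set Implicit Arguments.
Unset Strict Implicit.
Unset Printing Implicit Defensive.

Import Order.TTheory.

Local Open Scope classical_set_scope.
Local Open Scope order_scope.

(* A topologized poset is a [POrderedTopological.type d]: that structure only
   joins a topology and a partial order, with no compatibility axiom. *)

Section ProductOrder.
Context (d : Order.disp_t) (I : Type) (T : I -> POrderedTopological.type d).
Implicit Types x y z : prod_topology T.

Definition prod_le x y : bool := `[< forall i, x i <= y i >].

Lemma prod_le_refl : reflexive prod_le.
Proof. by move=> x; apply/asboolP => i. Qed.

Lemma prod_le_anti : antisymmetric prod_le.
Proof.
move=> x y /andP[/asboolP xy /asboolP yx].
by apply: functional_extensionality_dep => i; apply/le_anti; rewrite xy yx.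
Qed.

Lemma prod_le_trans : transitive prod_le.
Proof.
move=> y x z /asboolP xy /asboolP yz; apply/asboolP => i.
exact: le_trans (xy i) (yz i).
Qed.

HB.instance Definition _ := Order.Le_isPOrder.Build d (prod_topology T)
  prod_le_refl prod_le_anti prod_le_trans.

Lemma prod_leP x y : reflect (forall i, x i <= y i) (x <= y).
Proof. exact: asboolP. Qed.

End ProductOrder.

Definition up_directed d (T : porderType d) (D : set T) : Prop :=
  forall x y, D x -> D y -> exists z, [/\ D z, x <= z & y <= z].

(* The cardinal [kappa] is represented by a type [K] of that cardinality. *)
Definition up_complete (K : Type) d (T : POrderedTopological.type d) : Prop :=
  forall D : set T, D !=set0 -> up_directed D -> (D #<= [set: K])%card ->
    exists2 s : T, isLub D s & closure D s.

(* Main.v *)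
(** The point is that in an up-complete topologized poset a directed set [D],
    seen as a net, converges to its supremum [s]: otherwise the points of [D]
    outside some neighborhood [U] of [s] form a cofinal subset of [D], which is
    again directed with supremum [s], so [s] is in the closure of a set disjoint
    from [U].  Unlike [s \in closure D], net convergence can be checked
    coordinatewise in a product. *)
Require Import Defs.
From mathcomp Require Import all_boot all_order all_classical topology.

Import Order.TTheory.

Local Open Scope classical_set_scope.

(** Filter form of the net given by [D] indexed by itself: convergence of the net is convergence of
    this filter. *)
Definition up_tails {d} {T : porderType d} (D : set T) : set_system T :=
  filter_from D (fun y => D `&` [set x | (y <= x)%O]).

Section Directed.
Context {d : Order.disp_t} {T : porderType d}.
Implicit Types D E : set T.

Definition cofinal_in D E := forall x, D x -> exists2 y, E y & (x <= y)%O.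

Lemma up_tails_proper D : D !=set0 -> up_directed D -> ProperFilter (up_tails D).
Proof.
move=> D0 Ddir; apply: filter_from_proper => [|y Dy]; last by exists y; split => /=.
apply: filter_from_filter => // x y Dx Dy.
have [z [Dz xz yz]] := Ddir _ _ Dx Dy.
by exists z => // t [Dt /= zt]; split; split => //=; exact: le_trans zt.
Qed.

Lemma cofinal_up_directed D E :
  E `<=` D -> cofinal_in D E -> up_directed D -> up_directed E.
Proof.
move=> ED DE Ddir x y /ED Dx /ED Dy.
have [z [/DE[t Et zt] xz yz]] := Ddir _ _ Dx Dy.
by exists t; split => //; exact: le_trans zt.
Qed.

Lemma cofinal_isLub D E s : E `<=` D -> cofinal_in D E -> isLub E s -> isLub D s.
Proof.
move=> ED DE [sub slub]; split => [x /DE[y /sub ys xy]|b bub].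
  exact: le_trans ys.
by apply: slub => x /ED /bub.
Qed.

Lemma isLub_unique D s t : isLub D s -> isLub D t -> s = t.
Proof. by move=> [us ls] [ut lt]; apply/le_anti; rewrite ls ?lt. Qed.

End Directed.

Lemma homo_up_directed {d d'} {T : porderType d} {T' : porderType d'}
    (f : T -> T') (D : set T) :
  {homo f : x y / (x <= y)%O} -> up_directed D -> up_directed (f @` D).
Proof.
move=> fle Ddir _ _ [x Dx <-] [y Dy <-].
have [z [Dz xz yz]] := Ddir _ _ Dx Dy.
by exists (f z); split; [exists z | exact: fle | exact: fle].
Qed.

Lemma up_complete_cvg (K : Type) d (T : POrderedTopological.type d)
    (D : set T) (s : T) :
  up_complete K T -> D !=set0 -> up_directed D -> (D #<= [set: K])%card ->
  isLub D s -> up_tails D --> s.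
Proof.
move=> Tc D0 Ddir DK Ds U sU; apply: contrapT => tailsU.
pose E := D `&` ~` U.
have ED : E `<=` D by move=> x [].
have DE : cofinal_in D E.
  (* If no point of [E] lies above [y], the whole tail of [D] above [y] is inside [U]. *)
  move=> y Dy; apply: contrapT => noE; apply: tailsU.
  exists y => // x [Dx /= yx]; apply: contrapT => Ux.
  by apply: noE; exists x.
have E0 : E !=set0 by have [x /DE[y Ey _]] := D0; exists y.
have EK : (E #<= [set: K])%card := card_le_trans (subset_card_le ED) DK.
(* Completeness yields some supremum [t] of [E]; cofinality makes it a supremum of [D], hence equal
   to [s]. *)
have [t Et tE] := Tc _ E0 (cofinal_up_directed _ _ ED DE Ddir) EK.
have ts : t = s := isLub_unique _ _ _ (cofinal_isLub _ _ _ ED DE Et) Ds.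
by rewrite ts in tE; have [x [[_ nUx] Ux]] := tE U sU.
Qed.

(** The product topology is the supremum of the initial topologies of the projections; in the [i]-th
    of these, a neighborhood of [s] contains the preimage of an open set around [s i]. *)
Lemma cvg_prod_topology (I : Type) (T : I -> topologicalType)
    (F : set_system (prod_topology T)) (s : prod_topology T) :
  Filter F -> (forall i, (fun x : prod_topology T => x i) @ F --> s i) -> F --> s.
Proof.
move=> FF Fs; apply/cvg_sup => i U /=.
rewrite (@nbhsE (initial_topology (fun x : prod_topology T => x i))).
move=> -[_ [[V oV <-] Vs] VU].
apply: filterS VU _; apply: (Fs i).
exact: open_nbhs_nbhs.
Qed.

Lemma prod_isLub d (I : Type) (T : I -> POrderedTopological.type d)
    (D : set (prod_topology T)) (s : prod_topology T) :
  (forall i, isLub [set x i | x in D] (s i)) -> isLub D s.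
Proof.
move=> Ds; split => [x Dx|b bub]; apply/prod_leP => i.
  by apply: (Ds i).1; exists x.
by apply: (Ds i).2 => _ [x Dx <-]; have /prod_leP := bub x Dx; apply.
Qed.

Theorem theorem3p1 (K : Type) (K_infinite : infinite_set [set: K])
    (d : Order.disp_t) (A : Type) (X : A -> POrderedTopological.type d)
    (X_complete : forall a : A, up_complete K (X a)) :
  up_complete K (prod_topology X).
Proof.
move=> D D0 Ddir DK.
pose Dp a : set (X a) := [set x a | x in D].
have Dp0 a : Dp a !=set0 by have [x Dx] := D0; exists (x a), x.
have Dpdir a : up_directed (Dp a).
  by apply: homo_up_directed Ddir => x y /prod_leP xy; exact: xy.
have DpK a : (Dp a #<= [set: K])%card := card_le_trans (card_image_le _ D) DK.
have Dpsup a := cid2 (X_complete a _ (Dp0 a) (Dpdir a) (DpK a)).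
pose s a := s2val (Dpsup a).
have Dps a : isLub (Dp a) (s a) := s2valP (Dpsup a).
exists s; first exact: prod_isLub.
have Dproper := up_tails_proper _ D0 Ddir.
have Ds : up_tails D --> (s : prod_topology X).
  apply: cvg_prod_topology => a U sU.
  (* A tail of the projection [Dp a] inside [U] starts at [y a] for some [y] in [D]; the tail of [D]
     above [y] projects into it. *)
  have [_ [y Dy <-] yU] :=
    up_complete_cvg _ _ _ _ _ (X_complete a) (Dp0 a) (Dpdir a) (DpK a) (Dps a) U sU.
  exists y => // x [Dx /= /prod_leP yx]; apply: yU.
  by split; [exists x | exact: yx].
(* A tail of [D] contained in [U] contains its own starting point [y], so [U] meets [D]. *)
by move=> U /Ds [y Dy yU]; exists y; split => //; apply: yU; split=> /=.
Qed.
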